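(* Let $q\ge3$ be an integer, let $\mathbb{T}_q=(V,E)$ be the $q$-regular tree endowed with counting measure and unit edge weights, let $1<p<\infty$, let $\Omega\subset V$ be a nonempty finite subset, and let $w:\Omega\to[0,\infty)$ with $w\not\equiv0$. Then $$\lambda_{1,p}(\Omega,w)\ge\frac{c_{p,q}}{\|w\|_{\ell^1(\Omega,\mu)}},\qquad\text{where } c_{p,q}=q\left(1-(q-1)^{-\frac{1}{p-1}}\right)^{p-1}.$$
   Context: The $q$-regular tree $\mathbb{T}_q=(V,E)$ is the infinite connected graph without cycles in which every vertex has degree $q$; $x\sim y$ iff $\{x,y\}\in E$. It is endowed with $\mu(x)=1$ for all $x\in V$, and $\omega_{xy}=1$ if $x\sim y$, $\omega_{xy}=0$ otherwise. $X_V(\Omega)=\{u:V\to\mathbb{R}:u=0\text{ in }V\setminus\Omega\}$; $E_p(u)=\frac12\sum_{x,y\in V}\omega_{xy}|u(y)-u(x)|^p$; $\|w\|_{\ell^1(\Omega,\mu)}=\sum_{x\in\Omega}\mu(x)|w(x)|$. The first weighted Dirichlet eigenvalue is $$\lambda_{1,p}(\Omega,w)=\inf\left\{\frac{E_p(u)}{\sum_{x\in\Omega}\mu(x)w(x)|u(x)|^p}:\ u\in X_V(\Omega),\ \sum_{x\in\Omega}\mu(x)w(x)|u(x)|^p>0\right\}.$$ *)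

(* Defs.v *)
From HB Require Import structures.
From mathcomp Require Import all_boot all_order all_algebra finmap.
From mathcomp Require Import all_classical all_reals all_analysis.

Set Implicit Arguments.
Unset Strict Implicit.
Unset Printing Implicit Defensive.

Import Order.TTheory GRing.Theory Num.Theory.
Import numFieldNormedType.Exports.

Local Open Scope classical_set_scope.
Local Open Scope ring_scope.

Section RegularTree.
Variables (V : choiceType) (e : rel V).

Definition graph_connected :=
  forall x y : V, exists2 s : seq V, path e x s & last x s = y.

(* A back-and-forth traversal of one edge, [:: x; y], is a ucycle of size 2,
   hence the bound on the size. *)
Definition graph_acyclic :=
  forall s : seq V, (2 < size s)%N -> ~ ucycle e s.

Definition graph_regular (q : nat) :=
  forall x : V, ([set y | e x y] #= `I_q)%card.

(* q-regular trees are unique up to isomorphism, so T_q is rendered as any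
   graph with the following properties. *)
Record is_regular_tree (q : nat) : Prop := IsRegularTree {
  regular_tree_sym : symmetric e;
  regular_tree_irr : irreflexive e;
  regular_tree_inf : infinite_set [set: V];
  regular_tree_connected : graph_connected;
  regular_tree_acyclic : graph_acyclic;
  regular_tree_regular : graph_regular q }.

Definition unit_edge_weight (R : realType) (x y : V) : R := (e x y)%:R.

End RegularTree.

Definition unit_measure (R : realType) (V : choiceType) (x : V) : R := 1.

Section DirichletEigenvalue.
Variables (R : realType) (V : choiceType).
Variables (mu : V -> R) (omega : V -> V -> R).

(* The double sum runs over the infinite set V * V, so it is taken in the
   extended reals. *)
Definition energy (p : R) (u : V -> R) : \bar R :=
  ((2^-1)%:E * \esum_(z in [set: V * V])
     (omega z.1 z.2 * `|u z.2 - u z.1| `^ p)%:E)%E.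

Definition X_V (Omega : {fset V}) : set (V -> R) :=
  [set u | forall x, x \notin Omega -> u x = 0].

Definition weighted_psum (p : R) (Omega : {fset V}) (w : Omega -> R)
    (u : V -> R) : R :=
  \sum_(x : Omega) mu (val x) * w x * `|u (val x)| `^ p.

Definition lambda1 (p : R) (Omega : {fset V}) (w : Omega -> R) : \bar R :=
  ereal_inf [set (energy p u / (weighted_psum p w u)%:E)%E |
    u in [set u | X_V Omega u /\ 0 < weighted_psum p w u]].

Definition l1norm (Omega : {fset V}) (w : Omega -> R) : R :=
  \sum_(x : Omega) mu (val x) * `|w x|.

End DirichletEigenvalue.

Definition c_pq (R : realType) (p : R) (q : nat) : R :=
  q%:R * (1 - (q%:R - 1) `^ (- (1 / (p - 1)))) `^ (p - 1).

(* Main.v *)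
Require Import Defs.
From HB Require Import structures.
From mathcomp Require Import all_boot all_order all_algebra finmap.
From mathcomp Require Import all_classical all_reals all_analysis.
Import Order.TTheory GRing.Theory Num.Theory.
Import numFieldNormedType.Exports.
Local Open Scope classical_set_scope.
Local Open Scope fset_scope.
Local Open Scope ring_scope.

(** The eigenvalue bound is a statement about the p-capacity of a point:
    for every vertex [o] and every finitely supported [u],
    [c_pq p q * |u o|^p <= E_p(u)] (lemma [point_le_energy]).  Summing this
    over [Omega] against [w] gives [c_pq p q * sum w |u|^p <= l1norm w * E_p(u)],
    which is the claim.

    The extremal function for the capacity of [o] is [g(x) = r ^ d(o, x)] with
    [r = (q - 1) ^ (- 1 / (p - 1))]: it is p-harmonic away from [o], and its
    p-Laplacian at [o] equals [c_pq p q] up to sign.  Picone's inequality for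
    the pair [|u|, g] then yields the bound.  On an edge from a vertex [x] to a
    child [y] (the tree being rooted at [o]) the distance cancels out of
    Picone's inequality, which becomes
      [|u y - u x|^p >= (1 - r)^(p - 1) * (|u x|^p - (q - 1) * |u y|^p)]
    and is just convexity of [t ^ p] (lemma [edge_powR_ge]).  Summing over all
    edges, the right-hand sides telescope: a vertex other than [o] is a parent
    [q - 1] times and a child once, with weight [- (q - 1)], so its
    contributions cancel, while [o] is a parent [q] times and never a child
    (lemma [regular_tree_flux]).  What is left is
    [q * (1 - r)^(p - 1) * |u o|^p].

    The tree structure enters through the orientation of the edges away from
    [o], which comes from the uniqueness of simple paths in an acyclic graph
    (lemmas [acyclic_simple_path_unique] and [regular_tree_parent]). *)

(** * Orienting a tree away from a root *)

(** Two simple paths that fork at [x] and meet again contain a cycle: follow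
    the first one up to its first vertex [z] on the second one, and return to
    [x] along the second one. *)
Lemma acyclic_simple_path_unique (V : choiceType) (e : rel V) :
  symmetric e -> graph_acyclic e ->
  forall (s t : seq V) (x : V),
    path e x s -> path e x t -> uniq (x :: s) -> uniq (x :: t) ->
    last x s = last x t -> s = t.
Proof.
move=> esym eacy; elim=> [|a s IH] t x.
  case: t => [//|b t] _ _ _ /andP[xt _] /= xE.
  by move: xt; rewrite xE mem_last.
case: t => [|b t] ps pt us ut lE.
  by move: us => /andP[+ _]; rewrite -[X in X \notin _]lE /= mem_last.
have [ab|anb] := eqVneq a b.
  subst b; move: ps pt us ut => /= /andP[_ ps] /andP[_ pt] /andP[_ us] /andP[_ ut].
  by rewrite (IH t a).
(* The heads stay in the paths [S] and [T], since the meeting vertex may be [a]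
   or [b] itself. *)
have lST : last x (a :: s) \in b :: t by rewrite lE /= mem_last.
have hne : head x (a :: s) != head x (b :: t) by [].
exfalso; move: (a :: s) (b :: t) ps pt us ut lST hne => S T pS pT uS uT lST hne.
have hT : has (mem T) S.
  apply/hasP; exists (last x S) => //; case: S lST {pS uS hne} => [|c S] /=.
    by move: uT => /= /andP[/negPf->].
  by rewrite mem_last.
case: (split_find hT) pS uS hne => z s1 s2 zT s1T.
rewrite cat_path rcons_path last_rcons => /andP[/andP[ps1 ez] _].
rewrite cat_rcons -cat_cons cat_uniq => /and3P[us1 s12 _] hne.
move: zT hne s1T pT uT => /= zT.
case/splitPr: zT => t1 t2 hne s1T.
rewrite -cat_rcons cat_path => /andP[pt1 _].
rewrite -cons_uniq -cat_cons cat_uniq => /and3P[ut1 _ _].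
(* The heads differ, so [s1] and [t1] are not both empty and the cycle has at
   least three vertices. *)
apply: (eacy (x :: s1 ++ z :: rev t1)).
  case: s1 hne {ps1 ez us1 s12 s1T} => [|c s1] /=.
    case: t1 {pt1 ut1} => [|d t1] /=; first by rewrite eqxx.
    by rewrite size_rev.
  by rewrite size_cat /= addnS.
rewrite /ucycle /ucycleb /cycle; apply/andP; split.
  rewrite rcons_cat cat_path ps1 /= ez /=.
  have := path.rev_path e x (rcons t1 z).
  rewrite last_rcons belast_rcons rev_cons => ->.
  by rewrite (eq_path (e' := e)) // => c d; rewrite esym.
rewrite -cat_cons cat_uniq us1 /=.
move: ut1; rewrite /= mem_rcons rcons_uniq inE negb_or.
move=> /andP[/andP[xz xt1] /andP[zt1 ut1]].
rewrite rev_uniq mem_rev zt1 ut1 !andbT.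
move: s12; rewrite /= !negb_or => /andP[-> _] /=.
apply/hasPn => y; rewrite mem_rev inE => yt1.
rewrite negb_or; apply/andP; split.
  by apply: contraNneq xt1 => <-.
move/hasPn: s1T => /(_ y) h; apply/negP => /h.
by rewrite /= mem_cat yt1.
Qed.

(** The parent of [y] is the last but one vertex of the simple path from [o] to
    [y].  An edge [x -- y] makes [y] a child of [x], or conversely, because the
    simple path to [x] either already goes through [y], and then must end with
    this edge, or can be extended by [y].  The last clause says that no edge is
    oriented both ways, so that each edge is counted once by its child. *)
Lemma regular_tree_parent (V : choiceType) (e : rel V) (q : nat) (o : V) :
  is_regular_tree e q ->
  exists par : V -> V,
    [/\ forall y, y != o -> e (par y) y,
        forall x y, e x y ->
          (x != o) && (par x == y) || (y != o) && (par y == x)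
      & forall y, y != o -> par y != o -> par (par y) != y].
Proof.
case=> esym eirr _ econ eacy _.
have ex x : exists s, [/\ path e o s, uniq (o :: s) & last o s = x].
  have [s ps <-] := econ o x.
  by case: (shortenP ps) => t pt ut _; exists t.
have [P /all_and3 [pP uP lP]] := choice ex.
pose par y := last o (take (size (P y)).-1 (P y)).
have PE s : path e o s -> uniq (o :: s) -> P (last o s) = s.
  by move=> ps us; apply: (acyclic_simple_path_unique V e esym eacy _ _ o).
have parE s y : path e o (rcons s y) -> uniq (o :: rcons s y) ->
    par y = last o s.
  move=> /PE /[apply]; rewrite last_rcons /par => ->.
  by rewrite size_rcons /= -cats1 take_size_cat.
have PN y : y != o -> exists2 s, P y = rcons s y & par y = last o s.
  move=> yo; move: (lP y) (pP y) (uP y); case/lastP: (P y) => [/= oy|s z].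
    by rewrite oy eqxx in yo.
  by rewrite last_rcons => -> ps us; exists s; rewrite // (parE s).
exists par; split.
- move=> y /PN[s Py ->]; have := pP y.
  by rewrite Py rcons_path => /andP[].
- move=> x y exy; have [yP|yP] := boolP (y \in o :: P x).
    move: yP (pP x) (uP x) (lP x) => /= yP.
    case: (P x) / (splitPl yP) => s1 s2 ls1.
    rewrite cat_path ls1 => /andP[ps1 _].
    rewrite -cons_uniq -cat_cons cat_uniq => /and3P[us1 /hasPn s12 _].
    rewrite last_cat ls1 => lx.
    have xs2 : x \in s2.
      case: s2 lx {s12} => [/= yx|c s2 /= <-]; last by rewrite mem_last.
      by rewrite yx eirr in exy.
    have /norP[xo xs1] := s12 x xs2.
    rewrite xo (parE s1) ?ls1 ?eqxx//.
      by rewrite rcons_path ps1 ls1 esym.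
    by rewrite -rcons_cons rcons_uniq us1 inE negb_or xo xs1.
  move: (yP); rewrite inE negb_or => /andP[yo _].
  rewrite yo (parE (P x) y) ?lP ?eqxx ?orbT//.
    by rewrite rcons_path pP lP exy.
  by rewrite -rcons_cons rcons_uniq yP uP.
- move=> y /PN[s Py pary] paro.
  have := uP y; rewrite Py -rcons_cons rcons_uniq => /andP[ys us].
  have := pP y; rewrite Py rcons_path => /andP[ps _].
  have [t Pt ->] := PN _ paro.
  apply: contraNneq ys => <-.
  have -> : s = rcons t (par y) by rewrite -Pt pary PE.
  by rewrite -rcons_cons mem_rcons inE mem_last orbT.
Qed.

(** * Picone's inequality on an edge *)

Lemma powR_perspective (R : realType) (p s X : R) : 0 < s -> 0 <= X ->
  s * (X / s) `^ p = s `^ (- (p - 1)) * X `^ p.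
Proof.
move=> s0 X0; rewrite powRM ?invr_ge0// ?ltW//.
have -> : s^-1 `^ p = s `^ (- p) by rewrite -powR_inv1 ?ltW// -powRrM mulN1r.
rewrite mulrCA mulrC; congr (_ * _).
rewrite -{1}[s]powRr1 ?ltW// -powRD; last by rewrite (gt_eqF s0) implybT.
by rewrite opprB.
Qed.

(** Write [|a| <= (1 - r) * (|b - a| / (1 - r)) + r * (|b| / r)] and use convexity
    of the p-th power.  There is equality for [b = r * a], [0 <= a], that is
    along the extremal function [r ^ d(o, x)]. *)
Lemma edge_powR_ge (R : realType) (p r a b : R) : 1 <= p -> 0 < r < 1 ->
  (1 - r) `^ (p - 1) * (`|a| `^ p - r `^ (- (p - 1)) * `|b| `^ p)
    <= `|b - a| `^ p.
Proof.
move=> p1 /andP[r0 r1]; have s0 : 0 < 1 - r by rewrite subr_gt0.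
have p0 : 0 <= p by apply: le_trans p1.
rewrite -ler_pdivlMl ?powR_gt0// -powRN lerBlDr.
rewrite -!powR_perspective//.
have aE : `|a| <= (1 - r) * (`|b - a| / (1 - r)) + r * (`|b| / r).
  rewrite ![_ * (_ / _)]mulrC !divfK ?gt_eqF//.
  by rewrite -{1}(subrK b a) (le_trans (ler_normD _ _))// distrC.
apply: (@le_trans _ _ (((1 - r) * (`|b - a| / (1 - r)) + r * (`|b| / r)) `^ p)).
  by rewrite ge0_ler_powR ?nnegrE// (le_trans _ aE).
have s1 : 1 - r <= 1 by rewrite lerBlDr lerDl ltW.
(* [convex_powR] wants the second weight in the form [1 - (1 - r)]. *)
rewrite -{3 7}(subKr 1 r).
by apply: (convex_powR p1 (Itv01 (ltW s0) s1));
  rewrite inE /= in_itv /= divr_ge0 // ltW.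
Qed.

(** * Summation over the edges *)

(** Every edge occurs in the energy in both directions, which compensates the
    factor [1/2]; the condition on [par (par y)] keeps the edges attached to
    different vertices of [L] distinct. *)
Lemma energy_ge_edges (R : realType) (V : choiceType) (e : rel V) (p : R)
    (u : V -> R) (par : V -> V) (L : seq V) :
  symmetric e -> uniq L -> {in L, forall y, e (par y) y} ->
  {in L, forall y, par y \in L -> par (par y) != y} ->
  ((\sum_(y <- L) `|u y - u (par y)| `^ p)%:E
     <= energy (unit_edge_weight e R) p u)%E.
Proof.
move=> esym uL eL parL; rewrite /energy.
set S := \sum_(y <- L) _.
have -> : (S%:E = (2^-1)%:E * (S + S)%:E)%E.
  by rewrite -EFinM -mulr2n -[S *+ 2]mulr_natl mulrA mulVf ?mul1r ?pnatr_eq0.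
apply: lee_wpmul2l; first by rewrite lee_fin invr_ge0.
pose D := [seq (par y, y) | y <- L] ++ [seq (y, par y) | y <- L].
have uD : uniq D.
  rewrite cat_uniq !map_inj_uniq ?uL ?andbT /=; last 2 first.
  - by move=> y z [].
  - by move=> y z [].
  apply/hasPn => _ /mapP[y yL ->]; apply/negP => /= /mapP[z zL [yE zE]].
  by have := parL _ yL; rewrite zE -yE => /(_ zL) /eqP; apply.
apply: esum_ge; exists [set` D]; first by split => //; exact: finite_seq.
rewrite -fsbig_seq// sumEFin lee_fin big_cat !big_map /=.
rewrite /S !big_seq lerD//; apply: ler_sum => y yL.
  by rewrite /unit_edge_weight eL// mul1r.
by rewrite /unit_edge_weight esym eL// mul1r distrC.
Qed.

Lemma sum_fibers (R : pzRingType) (V : eqType) (f : V -> R) (g : V -> V)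
    (L S : seq V) :
  uniq S -> (forall x, x \notin S -> f x = 0) ->
  \sum_(y <- L) f (g y) = \sum_(x <- S) (count (fun y => g y == x) L)%:R * f x.
Proof.
move=> uS fS; elim: L => [|y L IH] /=.
  by rewrite big_nil big1 // => x _; rewrite mul0r.
rewrite big_cons IH; under [RHS]eq_bigr do rewrite natrD mulrDl.
rewrite big_split /=; congr (_ + _).
have [yS|yS] := boolP (g y \in S).
  rewrite (bigD1_seq (g y)) //= eqxx mul1r big1 ?addr0 // => x.
  by rewrite eq_sym => /negPf->; rewrite mul0r.
rewrite fS// big_seq big1 // => x xS.
by case: eqP => [yx|_]; rewrite ?mul0r// -yx (negPf yS) in xS *.
Qed.

(** The telescoping of the edge inequalities, for [f = |u|^p].  Rewriting both
    sums as sums over vertices, the coefficient of [f x] is the number of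
    children of [x] in [L] minus [q - 1] if [x] itself is in [L]. *)
Lemma regular_tree_flux (R : realType) (V : choiceType) (e : rel V) (q : nat)
    (o : V) (f : V -> R) (Omega : {fset V}) :
  (0 < q)%N -> is_regular_tree e q -> (forall x, 0 <= f x) ->
  (forall x, x \notin Omega -> f x = 0) ->
  exists (par : V -> V) (L : seq V),
    [/\ uniq L, {in L, forall y, e (par y) y},
        {in L, forall y, par y \in L -> par (par y) != y}
      & q%:R * f o <= \sum_(y <- L) (f (par y) - (q%:R - 1) * f y)].
Proof.
move=> q0 tree f0 fO.
have [par [epar orient nopar]] := regular_tree_parent V e q o tree.
have ereg := regular_tree_regular tree.
pose N x := enum_fset (fset_set [set y | e x y]).
have NE x y : (y \in N x) = e x y.
  rewrite in_fset_set; last by apply/finite_setP; exists q.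
  by apply/idP/idP; rewrite inE.
have sN x : size (N x) = q by have := card_fset_set (ereg x).
have uN x : uniq (N x) by exact: fset_uniq.
(* All children of vertices of [S] must be in [L] for the count to be right.
   The vertices of [L] outside [S] only add zero terms [f y]. *)
pose S := undup (o :: enum_fset Omega).
have uS : uniq S by exact: undup_uniq.
have oS : o \in S by rewrite mem_undup inE eqxx.
have fS x : x \notin S -> f x = 0.
  by rewrite mem_undup inE negb_or => /andP[_ xO]; apply: fO.
pose L := [seq y <- undup (S ++ flatten [seq N x | x <- S]) | y != o].
have uL : uniq L by rewrite filter_uniq// undup_uniq.
have Lo y : y \in L -> y != o by rewrite mem_filter => /andP[].
have LN x y : x \in S -> e x y -> y != o -> y \in L.
  move=> xS exy yo; rewrite mem_filter yo mem_undup mem_cat.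
  by apply/orP; right; apply/flatten_mapP; exists x; rewrite ?NE.
exists par, L; split => //.
- by move=> y /Lo; exact: epar.
- by move=> y /Lo yo /Lo; exact: nopar.
rewrite big_split /= sumrN -mulr_sumr (sum_fibers R V f par L S)//.
rewrite (sum_fibers R V f id L S)// mulr_sumr -sumrB.
have children x : x \in S ->
    (q * (x == o) + q.-1 * count_mem x L <= count (fun y => par y == x) L)%N.
  move=> xS; have [->|xo] := eqVneq x o.
    rewrite (count_memPn _) ?muln0 ?addn0 ?muln1; last by apply/negP => /Lo/eqP.
    rewrite -(sN o) -size_filter uniq_leq_size// => y; rewrite NE => eoy.
    have := orient _ _ eoy; rewrite eqxx /= => /andP[yo py].
    by rewrite mem_filter py; apply: LN eoy yo.
  have parx : par x \in N x by rewrite NE (regular_tree_sym tree) epar.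
  rewrite muln0 add0n count_uniq_mem//.
  apply: (@leq_trans q.-1); first by case: (_ \in _); rewrite ?muln1 ?muln0.
  rewrite -(sN x) -(size_rem parx) -size_filter.
  rewrite uniq_leq_size ?rem_uniq// => y.
  rewrite mem_rem_uniq// inE NE => /andP[ypx exy].
  have := orient _ _ exy; rewrite (eq_sym (par x)) (negPf ypx) andbF /= => /andP[yo py].
  by rewrite mem_filter py; apply: LN exy yo.
apply: (@le_trans _ _ (\sum_(x <- S) (q * (x == o))%:R * f x)).
  rewrite (bigD1_seq o)//= eqxx muln1 big1 ?addr0// => x /negPf->.
  by rewrite muln0 mul0r.
rewrite !big_seq; apply: ler_sum => x xS.
rewrite mulrA -mulrBl ler_wpM2r// lerBrDr.
have -> : q%:R - 1 = q.-1%:R :> R by rewrite -subn1 natrB.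
by rewrite -natrM -natrD ler_nat children.
Qed.

(** * The capacity of a point and the eigenvalue bound *)

(** Rooting the tree at [o] itself makes [o] the only vertex whose contribution
    survives the telescoping.  The constant is the p-capacity of a point, hence
    optimal; it depends neither on [Omega] nor on [o]. *)
Lemma point_le_energy (R : realType) (q : nat) (hq : (3 <= q)%N)
    (V : choiceType) (e : rel V) (htree : is_regular_tree e q)
    (p : R) (hp : 1 < p) (Omega : {fset V}) (u : V -> R) (o : V) :
  X_V Omega u ->
  ((c_pq p q * `|u o| `^ p)%:E <= energy (unit_edge_weight e R) p u)%E.
Proof.
move=> uO.
have p10 : 0 < p - 1 by rewrite subr_gt0.
have Q1 : 1 < q%:R - 1 :> R by rewrite ltrBrDr -(natrD _ 1 1) ltr_nat.
have Q0 : 0 < q%:R - 1 :> R by apply: lt_trans Q1.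
pose r := (q%:R - 1) `^ (- (1 / (p - 1))) : R.
(* This choice of [r] is what makes the extremal function p-harmonic. *)
have rE : r `^ (- (p - 1)) = q%:R - 1.
  by rewrite /r -powRrM mulrNN divfK ?gt_eqF// powRr1 ?ltW.
have r01 : 0 < r < 1.
  rewrite powR_gt0//= ltNge; apply/negP => r1.
  have /(ler_powR r1) : - (p - 1) <= 0 by rewrite oppr_le0 ltW.
  by rewrite rE powRr0 leNgt Q1.
pose f x := `|u x| `^ p.
have f0 x : 0 <= f x by exact: powR_ge0.
have fO x : x \notin Omega -> f x = 0.
  by move=> /uO ux; rewrite /f ux normr0 powR0// gt_eqF// (lt_trans ltr01).
have [par [L [uL eL parL flux]]] :=
  regular_tree_flux R V e q o f Omega (ltnW (ltnW hq)) htree f0 fO.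
apply: le_trans
  (energy_ge_edges R V e p u par L (regular_tree_sym htree) uL eL parL).
rewrite lee_fin /c_pq -/r mulrAC mulrC.
apply: (@le_trans _ _ ((1 - r) `^ (p - 1) *
   \sum_(y <- L) (`|u (par y)| `^ p - (q%:R - 1) * `|u y| `^ p))).
  by rewrite ler_wpM2l ?powR_ge0.
rewrite mulr_sumr; apply: ler_sum => y _.
by rewrite -{1}rE edge_powR_ge ?ltW.
Qed.

Theorem corollary4p5 (R : realType) (q : nat) (hq : (3 <= q)%N)
  (V : choiceType) (e : rel V) (htree : is_regular_tree e q)
  (p : R) (hp : 1 < p)
  (Omega : {fset V}) (hOmega : Omega != fset0)
  (w : Omega -> R) (hw : forall x, 0 <= w x) (hw0 : exists x, w x != 0) :
  ((c_pq p q / l1norm (@unit_measure R V) w)%:E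
     <= lambda1 (@unit_measure R V) (@unit_edge_weight V e R) p w)%E.
Proof.
have l1E : l1norm (@unit_measure R V) w = \sum_(x : Omega) w x.
  by apply: eq_bigr => x _; rewrite mul1r ger0_norm.
have l1_gt0 : 0 < l1norm (@unit_measure R V) w.
  have [x wx] := hw0; rewrite l1E (bigD1 x)//=.
  by rewrite ltr_wpDr ?sumr_ge0// lt0r wx hw.
apply/ereal_infP => _ [u [uO W0] <-].
rewrite inver gt_eqF// lee_pdivlMr// -EFinM mulrAC.
have point x := point_le_energy R q hq V e htree p hp Omega u x uO.
case: (energy _ _ _) point => [E| |] point; last 2 first.
- by rewrite leey.
- by have [x _] := hw0; have := point (val x).
rewrite lee_fin ler_pdivrMr// l1E mulr_sumr /weighted_psum mulr_sumr.
apply: ler_sum => x _; rewrite mul1r mulrCA mulrC.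
by rewrite ler_wpM2r// -lee_fin.
Qed.
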